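(* Let $A=(g,F)\in\mathcal{R}(\mathbb{F})$. Assume that ${\bf h}$ is a given vector with generating series $h=h_0+\sum_{n\ge k}h_nx^n=h_0+h_kH(x)^k$, where $k\ge1$, $h_k\neq0$, and $$H(x)=x\left(1+\frac{h_{k+1}}{h_k}x+\frac{h_{k+2}}{h_k}x^2+\cdots\right)^{1/k}\in\mathcal{F}_1.$$ Let $\overline{H}$ be the compositional inverse of $H$ and let $D=\left(h_k^{-1}\left(\frac{h}{g}-h_0\right)\right)^{1/k}$. (a) If $h_0\neq0$, then $A\in\mathrm{stab}({\bf h})$ if and only if $g=1+\sum_{n\ge k}g_nx^n$ and $F=\overline{H}(D)$, where $f_1=[x]F$ is a root of $f_1^k=(h_k-h_0g_k)/h_k$. (b) If $h_0=0$, then $A\in\mathrm{stab}({\bf h})$ if and only if $g=g_0+\sum_{n\ge k}g_nx^n$ and $F=\overline{H}(D)$ with $h_0=0$, where $f_1=[x]F$ is a root of $f_1^k=1/g_0$.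
   Context: $\mathbb{F}$ is the field of real or complex numbers. $\mathcal{F}_0$ is the set of formal power series in $\mathbb{F}[[x]]$ with nonzero constant term, and $\mathcal{F}_1=x\mathcal{F}_0$. Write $g=\sum_{n\ge0}g_nx^n\in\mathcal{F}_0$ and $F=\sum_{n\ge1}f_nx^n\in\mathcal{F}_1$; $[x^i]$ denotes extraction of the coefficient of $x^i$. The Riordan matrix $(g,F)$ is the infinite lower triangular matrix $[a_{ij}]_{i,j\ge0}$ with $a_{ij}=[x^i]\,g(x)F(x)^j$; $\mathcal{R}(\mathbb{F})$ is the group of all Riordan matrices. The generating series of ${\bf h}=(h_0,h_1,\ldots)^T$ with entries in $\mathbb{F}$ is $h(x)=\sum_{n\ge0}h_nx^n$. The stabilizer subgroup of ${\bf h}$ is $\mathrm{stab}({\bf h})=\{(g,F)\in\mathcal{R}(\mathbb{F})\mid (g,F){\bf h}={\bf h}\}$; the condition $(g,F){\bf h}={\bf h}$ is equivalent to $g(x)h(F(x))=h(x)$. For a series $B=1+b_1x+\cdots$, $B^{1/k}$ denotes the unique series with constant term $1$ whose $k$-th power is $B$. For a series $C=c_kx^k+c_{k+1}x^{k+1}+\cdots$ with $c_k\neq0$ and each $b\in\mathbb{F}$ with $b^k=c_k$, there is a unique series $B=bx+\cdots$ with $B^k=C$; the $k$-th root $D$ is understood in this sense, as a series in $\mathcal{F}_1$ with leading coefficient $f_1$.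
   Formalization: In (b) the condition g = g_0 + sum_{n>=k} g_n x^n is dropped from the right-hand side: it is not necessary when k >= 2, e.g. h = x^2, g = (1+x)^(-2), F = x + x^2 gives g h(F) = h with g_1 = -2. *)

(* Defs.v *)
From HB Require Import structures.
From mathcomp Require Import all_boot all_order all_algebra.
From mathcomp Require Import all_classical all_reals.
From mathcomp Require Import complex.
Set Implicit Arguments.
Unset Strict Implicit.
Unset Printing Implicit Defensive.
Import Order.TTheory GRing.Theory Num.Theory.
Local Open Scope classical_set_scope.
Local Open Scope ring_scope.

(* "K is the field of real or complex numbers": R is a model of the reals, and
   R[i] its complexification. *)
Inductive real_or_complex (R : realType) : numFieldType -> Prop :=
| RealScalars : real_or_complex R R
| ComplexScalars : real_or_complex R R[i].

(* FPS h is the generating series of h; [x^n] a is written a n. A record is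
   used because functions already carry a pointwise ring structure. *)
Record fps (K : Type) : Type := FPS { fps_coef :> nat -> K }.

Section FpsRing.
Variable K : fieldType.
Implicit Types a b c : fps K.

Lemma fpsP a b : (forall n, a n = b n) -> a = b.
Proof. by case: a b => a [b] /= ab; congr FPS; apply/funext. Qed.

HB.instance Definition _ := gen_eqMixin (fps K).
HB.instance Definition _ := gen_choiceMixin (fps K).

Let add a b : fps K := FPS (fun n => a n + b n).
Let opp a : fps K := FPS (fun n => - a n).
Let zero : fps K := FPS (fun=> 0).

Let addA : associative add.
Proof. by move=> a b c; apply: fpsP => n /=; rewrite addrA. Qed.
Let addC : commutative add.
Proof. by move=> a b; apply: fpsP => n /=; rewrite addrC. Qed.
Let add0 : left_id zero add.
Proof. by move=> a; apply: fpsP => n /=; rewrite add0r. Qed.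
Let addN : left_inverse zero opp add.
Proof. by move=> a; apply: fpsP => n /=; rewrite addNr. Qed.

HB.instance Definition _ := GRing.isZmodule.Build (fps K) addA addC add0 addN.

Definition fpsC (u : K) : fps K := FPS (fun n => if n is 0 then u else 0).
Definition fpsX : fps K := FPS (fun n => (n == 1%N)%:R).

Let mul a b : fps K := FPS (fun n => \sum_(i < n.+1) a i * b (n - i)%N).

Definition fps_trunc m a : {poly K} := \poly_(i < m.+1) a i.

Let coef_trunc m a n : (n <= m)%N -> (fps_trunc m a)`_n = a n.
Proof. by move=> nm; rewrite coef_poly ltnS nm. Qed.

Let mul_trunc m a b n :
  (n <= m)%N -> mul a b n = (fps_trunc m a * fps_trunc m b)`_n.
Proof.
move=> nm; rewrite coefM /=; apply: eq_bigr => i _.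
by rewrite !coef_trunc // (leq_trans _ nm) ?leq_subr ?leq_ord.
Qed.

Let mulC : commutative mul.
Proof.
by move=> a b; apply: fpsP => n; rewrite !(@mul_trunc n) // mulrC.
Qed.

Let mulA : associative mul.
Proof.
move=> a b c; apply: fpsP => n.
have -> : mul a (mul b c) n =
          (fps_trunc n a * (fps_trunc n b * fps_trunc n c))`_n.
  rewrite [in RHS]coefM; apply: eq_bigr => i _.
  by rewrite (coef_trunc _ (leq_ord i)) (@mul_trunc n) // leq_subr.
have -> : mul (mul a b) c n =
          (fps_trunc n a * fps_trunc n b * fps_trunc n c)`_n.
  rewrite [in RHS]coefM; apply: eq_bigr => i _.
  by rewrite coef_trunc ?leq_subr // (@mul_trunc n) // leq_ord.
by rewrite mulrA.
Qed.

Let mul1 : left_id (fpsC 1) mul.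
Proof.
move=> a; apply: fpsP => n /=; rewrite big_ord_recl /= mul1r subn0.
by rewrite big1 ?addr0 // => i _; rewrite mul0r.
Qed.

Let mulD : left_distributive mul +%R.
Proof.
move=> a b c; apply: fpsP => n /=; rewrite -big_split /=.
by apply: eq_bigr => i _; rewrite mulrDl.
Qed.

Let one_neq0 : fpsC 1 != 0.
Proof. by apply/eqP => /(congr1 (fun a : fps K => a 0%N)) /eqP; rewrite /= oner_eq0. Qed.

HB.instance Definition _ :=
  GRing.Zmodule_isComNzRing.Build (fps K) mulA mulC mul1 mulD one_neq0.

Lemma fpsE0 n : (0 : fps K) n = 0. Proof. by []. Qed.
Lemma fpsE1 n : (1 : fps K) n = if n is 0 then 1 else 0. Proof. by []. Qed.
Lemma fpsD a b n : (a + b) n = a n + b n. Proof. by []. Qed.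
Lemma fpsN a n : (- a) n = - a n. Proof. by []. Qed.
Lemma fpsM a b n : (a * b) n = \sum_(i < n.+1) a i * b (n - i)%N.
Proof. by []. Qed.
Lemma fpsM0 a b : (a * b) 0%N = a 0%N * b 0%N.
Proof. by rewrite fpsM big_ord1. Qed.

Lemma fpsM1 a b : (a * b) 1%N = a 0%N * b 1%N + a 1%N * b 0%N.
Proof. by rewrite fpsM !big_ord_recl big_ord0 addr0. Qed.

Lemma fpsCM u a n : (fpsC u * a) n = u * a n.
Proof.
rewrite fpsM big_ord_recl /= subn0 big1 ?addr0 // => i _.
by rewrite mul0r.
Qed.

Lemma fps_sum I (r : seq I) (P : pred I) (E : I -> fps K) n :
  (\sum_(i <- r | P i) E i) n = \sum_(i <- r | P i) E i n.
Proof. by apply: (big_morph (fun a : fps K => a n)). Qed.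

Lemma fpsX_lt a j n : a 0%N = 0 -> (n < j)%N -> (a ^+ j) n = 0.
Proof.
move=> a0; elim: j n => [//|j IH] n nj; rewrite exprS fpsM big1 // => -[[|i] /= ilt] _.
  by rewrite a0 mul0r.
case: n nj ilt => // n nj _.
by rewrite IH ?mulr0 // subSS (leq_ltn_trans (leq_subr _ _)).
Qed.

Lemma fps_trunc_mul a b c n :
  (forall i, (i <= n)%N -> b i = c i) -> (a * b) n = (a * c) n.
Proof. by move=> bc; rewrite !fpsM; apply: eq_bigr => i _; rewrite bc // leq_subr. Qed.

(* The geometric series a_0^-1 * \sum_j (1 - a/a_0)^j; only j <= n contributes
   to the n-th coefficient. *)
Let inv a : fps K :=
  if a 0%N == 0 then a else
  FPS (fun n => (a 0%N)^-1 * \sum_(j < n.+1) ((1 - fpsC (a 0%N)^-1 * a) ^+ j) n).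

Let unit : {pred fps K} := fun a => a 0%N != 0.

Let mulVx : {in unit, left_inverse 1 inv *%R}.
Proof.
move=> a; rewrite unfold_in /= => a0; rewrite /inv (negPf a0).
set c := fpsC _; set u := 1 - c * a.
have u0 : u 0%N = 0 by rewrite fpsD fpsN fpsM0 /= mulVf // subrr.
apply: fpsP => n; rewrite mulrC.
rewrite (@fps_trunc_mul _ _ (c * \sum_(j < n.+1) u ^+ j)); last first.
  move=> i ile; rewrite fpsCM /=; congr (_ * _); rewrite fps_sum.
  rewrite (big_ord_widen n.+1 (fun j => (u ^+ j) i)) //.
  rewrite [LHS]big_mkcond; apply: eq_bigr => j _.
  by case: ltnP => // ij; rewrite fpsX_lt.
have -> : a * (c * \sum_(j < n.+1) u ^+ j) = 1 - u ^+ n.+1.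
  by rewrite mulrA [a * c]mulrC -[RHS]opprB subrX1 -mulNr opprB /u subKr.
by rewrite fpsD fpsN fpsX_lt // subr0.
Qed.

Let unitPl a b : b * a = 1 -> unit a.
Proof.
move=> /(congr1 (fun a : fps K => a 0%N)); rewrite fpsM0 /= => ba1.
apply/negP => /eqP a0; move: ba1; rewrite a0 mulr0 => /esym/eqP.
by rewrite oner_eq0.
Qed.

Let inv_out : {in [predC unit], inv =1 id}.
Proof. by move=> a; rewrite inE negbK /inv => ->. Qed.

HB.instance Definition _ :=
  GRing.ComNzRing_hasMulInverse.Build (fps K) mulVx unitPl inv_out.

Lemma fps_unitE a : (a \is a GRing.unit) = (a 0%N != 0). Proof. by []. Qed.

End FpsRing.

Arguments fpsX {K}.

Section Riordan.
Variable K : fieldType.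
Implicit Types (g h a B C F H : fps K) (v : nat -> K) (A : nat -> nat -> K).

Definition Fser0 : set (fps K) := [set g | g 0%N != 0].
Definition Fser1 : set (fps K) := [set fpsX * g | g in Fser0].

(* The substitution h(F), for F without constant term: then F^j has order at
   least j, so the sum giving [x^n] h(F) is finite. *)
Definition fps_comp h F : fps K :=
  FPS (fun n => \sum_(j < n.+1) h j * (F ^+ j) n).

Definition fps_compinv H : fps K :=
  xget 0 [set G : fps K | [/\ Fser1 G, fps_comp H G = fpsX & fps_comp G H = fpsX]].

(* The two readings of a k-th root: the root with constant term 1 of a series
   with constant term 1, and the root b x + ... of a series c_k x^k + ... with
   c_k = b^k <> 0. *)
Definition fps_root1 k B : fps K :=
  xget 0 [set S : fps K | S 0%N = 1 /\ S ^+ k = B].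

Definition fps_rootX k (b : K) C : fps K :=
  xget 0 [set D : fps K | [/\ Fser1 D, D 1%N = b & D ^+ k = C]].

Definition riordan g F : nat -> nat -> K := fun i j => (g * F ^+ j) i.

Definition Riordan : set (nat -> nat -> K) :=
  [set riordan g F | g in Fser0 & F in Fser1].

(* The product of a lower triangular matrix and a column vector. *)
Definition ltmulv A v : nat -> K := fun i => \sum_(j < i.+1) A i j * v j.

Definition stab v : set (nat -> nat -> K) :=
  [set A | Riordan A /\ ltmulv A v = v].

(* H = x (1 + (v_{k+1}/v_k) x + (v_{k+2}/v_k) x^2 + ...)^{1/k}, so that
   v_0 + v_k H^k is the generating series of v when v_1 = ... = v_{k-1} = 0. *)
Definition Hser k v : fps K :=
  fpsX * fps_root1 k (FPS (fun n => v (k + n)%N / v k)).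

(* D = (v_k^-1 (h/g - v_0))^{1/k} with [x] D = b, h the generating series. *)
Definition Dser k v g (b : K) : fps K :=
  fps_rootX k b (fpsC (v k)^-1 * (FPS v / g - fpsC (v 0%N))).

End Riordan.

(* When h_0 = 0, membership in the stabilizer does not force
   g = g_0 + O(x^k): h = x^2 is fixed by ((1 + x)^-2, x + x^2). *)
Lemma stab_not_gap (K : numFieldType) (v := fun n => (n == 2%N)%:R : K) :
  exists g F : fps K,
    [/\ Fser0 g, Fser1 F, stab v (riordan g F) & g 1%N != 0].
Proof.
pose p : fps K := 1 + fpsX.
have p0 : p 0%N = 1 by rewrite fpsD /= addr0.
have pU : p ^+ 2 \is a GRing.unit by rewrite unitrX // fps_unitE p0 oner_eq0.
pose g := (p ^+ 2)^-1; pose F := fpsX * p.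
have gp : g * p ^+ 2 = 1 by rewrite mulVr.
have p20 : (p ^+ 2) 0%N = 1 by rewrite expr2 fpsM0 p0 mulr1.
have p21 : (p ^+ 2) 1%N = 2%:R.
  by rewrite expr2 fpsM1 p0 mulr1 mul1r fpsD add0r.
have g0 : g 0%N = 1.
  by have := congr1 (fun a : fps K => a 0%N) gp; rewrite fpsM0 p20 mulr1.
have g1 : g 1%N = - 2%:R.
  have := congr1 (fun a : fps K => a 1%N) gp.
  rewrite fpsM1 g0 p20 p21 mul1r mulr1 addrC => /eqP.
  by rewrite addr_eq0 => /eqP.
have G0 : Fser0 g by rewrite /Fser0 /mkset g0 oner_eq0.
have F1 : Fser1 F by exists p => //; rewrite /Fser0 /mkset p0 oner_eq0.
exists g, F; split => //; last by rewrite g1 oppr_eq0 pnatr_eq0.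
split; first by exists g => //; exists F.
have gF : g * F ^+ 2 = fpsX ^+ 2 by rewrite exprMn mulrCA gp mulr1.
have X2 n : (fpsX ^+ 2 : fps K) n = (n == 2%N)%:R.
  case: n => [|n]; first by rewrite fpsX_lt.
  rewrite expr2 fpsM !big_ord_recl /= mul0r add0r mul1r subSS subn0.
  by rewrite big1 ?addr0 // => i _; rewrite mul0r.
apply/funext => i; rewrite /ltmulv /v.
have [i2|i2] := ltnP 2 i.+1.
  rewrite (bigD1 (Ordinal i2)) //= mulr1 big1 ?addr0; last first.
    by move=> j /negPf jn; rewrite -val_eqE /= in jn; rewrite jn mulr0.
  by rewrite /riordan gF X2.
rewrite big1; first by rewrite (ltn_eqF i2).
move=> j _; rewrite (ltn_eqF (leq_trans (ltn_ord j) _)) ?mulr0 //.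
Qed.

(* Main.v *)
From HB Require Import structures.
Require Import Defs.
From mathcomp Require Import all_boot all_order all_algebra.
From mathcomp Require Import all_classical all_reals.
Import Order.TTheory GRing.Theory Num.Theory.
Local Open Scope classical_set_scope.
Local Open Scope ring_scope.

(** Write [H] for [Hser k h], so that the generating series of [h] is
    [h_0 + h_k H^k], and let [C = h_k^-1 (h/g - h_0)].  The stabilizer equation
    [g h(F) = h] says exactly that [H(F)^k = C] ([stab_riordan_root]).

    Since [H = X + ...], the series [H(F)] lies in [Fser1] and has the same
    linear coefficient [f_1] as [F].  Hence [H(F)^k = C] forces [C] to be
    [f_1^k X^k + ...]; conversely such a [C] has a [k]-th root [D] with linear
    coefficient [f_1], and only one.  So the equation amounts to [H(F) = D],
    that is to [F] being the composite of the inverse of [H] with [D]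
    ([fps_compinv_root]).

    What remains is to read the condition [C = f_1^k X^k + ...] on [g].  As
    [g] is invertible, it can be read on [g C = (h - h_0 g) / h_k].  If [h_0] is
    nonzero, the coefficients below [k] vanish iff [g = 1 + O(X^k)], and the
    [k]-th one gives [f_1^k = (h_k - h_0 g_k) / h_k].  If [h_0 = 0], then
    [g C = h / h_k = X^k + ...] whatever [g] is, and the condition is
    [g_0 f_1^k = 1].

    The roots and the compositional inverse are obtained as fixed points of
    operators that are contracting for the [X]-adic distance
    ([fps_fixpoint]); associativity of composition follows from the fact that
    composition on the right with a series without constant term is a ring
    morphism ([fps_compM]), which is seen coefficient by coefficient on
    polynomial truncations. *)

Section PowerSeries.
Context {K : fieldType}.
Implicit Types a b c g h B C D E F G H : fps K.

(** * Coefficients and congruence modulo powers of X *)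

Lemma fpsXnM k a n : (fpsX ^+ k * a) n = if (n < k)%N then 0 else a (n - k)%N.
Proof.
elim: k n => [|k IH] n; first by rewrite expr0 mul1r ltn0 subn0.
rewrite exprS -mulrA fpsM; case: n => [|n].
  by rewrite big_ord1 /= mul0r.
rewrite big_ord_recl /= mul0r add0r big_ord_recl mul1r -fpsM (subn1 n.+1) IH.
by rewrite subSS big1 ?addr0 // => i _; rewrite mul0r.
Qed.

Lemma fpsXM a n : (fpsX * a) n = if n is n'.+1 then a n' else 0.
Proof. by rewrite -[fpsX]expr1 fpsXnM; case: n => [|n] //=; rewrite subn1. Qed.

Lemma fpsXnE k n : (fpsX ^+ k : fps K) n = (n == k)%:R.
Proof.
rewrite -[fpsX ^+ k]mulr1 fpsXnM fpsE1.
case: (ltngtP n k) => [//|kn|->]; last by rewrite subnn.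
by rewrite -(subnSK kn).
Qed.

(** [X^k] is a regular element. *)
Lemma fpsXnI k a b : fpsX ^+ k * a = fpsX ^+ k * b -> a = b.
Proof.
move=> ab; apply: fpsP => n; have := congr1 (fun c : fps K => c (k + n)%N) ab.
by rewrite !fpsXnM ltnNge leq_addr /= addKn.
Qed.

Lemma fps_dvdXn k a : (forall n, (n < k)%N -> a n = 0) ->
  a = fpsX ^+ k * FPS (fun n => a (k + n)%N).
Proof.
move=> ak; apply: fpsP => n; rewrite fpsXnM; case: ltnP => [/ak //|kn].
by rewrite /= subnKC.
Qed.

Lemma fpsMn a m n : (a *+ m) n = a n *+ m.
Proof. by elim: m => [|m IH]; rewrite ?mulr0n // !mulrS fpsD IH. Qed.

Lemma fpsX0 k a : (a ^+ k) 0%N = a 0%N ^+ k.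
Proof. by elim: k => [|k IH]; rewrite ?expr0 // !exprS fpsM0 IH. Qed.

Lemma fpsC_is_zmod_morphism : zmod_morphism (@fpsC K).
Proof. by move=> x y; apply: fpsP => -[|n]; rewrite fpsD fpsN //= subr0. Qed.

Lemma fpsC_is_monoid_morphism : monoid_morphism (@fpsC K).
Proof.
by split=> // x y; apply: fpsP => -[|n]; rewrite fpsCM //= mulr0.
Qed.

HB.instance Definition _ :=
  GRing.isZmodMorphism.Build K (fps K) (@fpsC K) fpsC_is_zmod_morphism.
HB.instance Definition _ :=
  GRing.isMonoidMorphism.Build K (fps K) (@fpsC K) fpsC_is_monoid_morphism.

Lemma Fser1P F : Fser1 F <-> F 0%N = 0 /\ F 1%N != 0.
Proof.
split=> [[c c0 <-]|[F0 F1]]; first by rewrite !fpsXM.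
exists (FPS (fun n => F (1 + n)%N)); first exact: F1.
by rewrite -[fpsX]expr1 -fps_dvdXn // => -[].
Qed.

(** Congruence modulo [X^n]. *)
Definition fps_eqmod n a b := forall i, (i < n)%N -> a i = b i.

Lemma fps_eqmodM n a a' b b' : fps_eqmod n a a' -> fps_eqmod n b b' ->
  fps_eqmod n (a * b) (a' * b').
Proof.
move=> aa' bb' i ni; rewrite !fpsM; apply: eq_bigr => j _.
rewrite aa' ?bb' // ?(leq_ltn_trans _ ni) ?leq_subr //.
by rewrite -ltnS.
Qed.

Lemma fps_eqmodX n k a b : fps_eqmod n a b -> fps_eqmod n (a ^+ k) (b ^+ k).
Proof.
by move=> ab; elim: k => [//|k IH]; rewrite !exprS; apply: fps_eqmodM.
Qed.

Lemma fps_eqmodV n a b : a \is a GRing.unit -> b \is a GRing.unit ->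
  fps_eqmod n a b -> fps_eqmod n a^-1 b^-1.
Proof.
move=> aU bU ab i ni.
have aV : b * (a^-1 * b^-1) = a^-1 by rewrite mulrCA mulrV ?mulr1.
have bV : a * (a^-1 * b^-1) = b^-1 by rewrite mulVKr.
rewrite -[in LHS]aV -[in RHS]bV.
by apply: (@fps_eqmodM n) => // j nj; rewrite ab.
Qed.

(** * Contracting operators *)

(** An operator for which the [n]-th coefficient of the value only involves
    the coefficients of index less than [n] of the argument is a contraction
    for the [X]-adic distance, hence has a fixed point. *)
Lemma fps_fixpoint (T : fps K -> fps K) :
  (forall n a b, fps_eqmod n a b -> T a n = T b n) -> exists a, T a = a.
Proof.
move=> Tc; pose u n := iter n T 0.
have uS n : fps_eqmod n (u n) (u n.+1).
  elim: n => [//|n IH] i ni; apply: Tc => j ji; apply: IH.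
  exact: leq_trans ji ni.
have uD i m : u (i.+1 + m)%N i = u i.+1 i.
  by elim: m => [|m IH]; rewrite ?addn0 // addnS -uS ?IH // ltnS leq_addr.
exists (FPS (fun n => u n.+1 n)); apply: fpsP => n /=.
by apply: Tc => i ni /=; rewrite -(subnKC ni) uD.
Qed.

(** * Roots *)

Lemma fps_root1_exists k B : k%:R != 0 :> K -> B 0%N = 1 ->
  exists S : fps K, S 0%N = 1 /\ S ^+ k = B.
Proof.
move=> k0 B0; have k_gt0 : (0 < k)%N by case: k k0; rewrite ?eqxx.
pose b : fps K := FPS (fun n => B n.+1).
have Bb : B = 1 + fpsX * b.
  by apply: fpsP => -[|n]; rewrite fpsD fpsXM fpsE1 ?addr0 ?add0r.
(* For S = 1 + X u, the equation S^k = 1 + X b reads k u + X (Q u) = b. *)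
pose Q u : fps K :=
  \sum_(i < k.-1) (fpsX ^+ i * u ^+ i.+2) *+ 'C(k, i.+2).
have Skey u : (1 + fpsX * u) ^+ k = 1 + fpsX * (u *+ k + fpsX * Q u).
  case: k k_gt0 {k0} @Q => // k _ Q.
  rewrite exprDn 2!big_ord_recl /= !expr1n !expr0 !mul1r bin0 mulr1n.
  rewrite /bump /= bin1 expr1 mulrDr mulrnAr; congr (_ + (_ + _)).
  rewrite mulrA -expr2 mulr_sumr; apply: eq_bigr => i _.
  by rewrite expr1n mul1r mulrnAr exprMn mulrA -exprD.
have Qc n u v : fps_eqmod n.+1 u v -> Q u n = Q v n.
  move=> uv; rewrite [LHS]fps_sum [RHS]fps_sum; apply: eq_bigr => i _.
  rewrite [LHS]fpsMn [RHS]fpsMn.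
  have E : fps_eqmod n.+1 (fpsX ^+ i * u ^+ i.+2) (fpsX ^+ i * v ^+ i.+2).
    exact: (fps_eqmodM _ _ _ _ _ (fun _ _ => erefl) (fps_eqmodX _ _ _ _ uv)).
  exact: (congr1 (fun x => x *+ _) (E n (ltnSn n))).
have [u Tu] : exists u : fps K, fpsC k%:R^-1 * (b - fpsX * Q u) = u.
  apply: fps_fixpoint => n u v uv.
  rewrite [LHS]fpsCM [RHS]fpsCM [in LHS]fpsD [in RHS]fpsD.
  rewrite [in LHS]fpsN [in RHS]fpsN [in LHS]fpsXM [in RHS]fpsXM.
  case: n uv => [//|n] uv.
  exact: (congr1 (fun x => k%:R^-1 * (b n.+1 - x)) (Qc n u v uv)).
exists (1 + fpsX * u); split; first by rewrite fpsD fpsXM addr0.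
rewrite Skey Bb; congr (1 + fpsX * _); apply/esym/eqP.
rewrite -subr_eq; apply/eqP; move: (b - _) Tu => w <-; apply: fpsP => n.
by rewrite [RHS]fpsMn [in RHS]fpsCM -[RHS]mulr_natl mulVKf.
Qed.

Lemma fps_root1P k B : k%:R != 0 :> K -> B 0%N = 1 ->
  (fps_root1 k B) 0%N = 1 /\ fps_root1 k B ^+ k = B.
Proof.
move=> k0 B0; apply: (@xgetPex _ 0 [set S : fps K | S 0%N = 1 /\ S ^+ k = B]).
exact: fps_root1_exists.
Qed.

Lemma fps_rootX_exists k (f : K) C : k%:R != 0 :> K -> f != 0 ->
  (forall n, (n < k)%N -> C n = 0) -> C k = f ^+ k ->
  exists D : fps K, [/\ Fser1 D, D 1%N = f & D ^+ k = C].
Proof.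
move=> k0 f0 Clt Ck; have fk0 : f ^+ k != 0 by rewrite expf_neq0.
pose B := fpsC (f ^+ k)^-1 * FPS (fun n => C (k + n)%N).
have B0 : B 0%N = 1 by rewrite fpsCM /= addn0 Ck mulVf.
have [S [S0 SB]] := fps_root1_exists _ _ k0 B0.
have D1 : (fpsX * (fpsC f * S)) 1%N = f by rewrite fpsXM fpsCM S0 mulr1.
exists (fpsX * (fpsC f * S)); split => //.
  by apply/Fser1P; rewrite D1 fpsXM.
rewrite !exprMn -rmorphXn SB [RHS](fps_dvdXn _ _ Clt); congr (_ * _).
by apply: fpsP => n; rewrite !fpsCM mulVKf.
Qed.

(** If [D = X d] and [E = X e], then [d^k - e^k] is the product of [d - e] by
    a series with constant term [k d_0^(k-1)], which is invertible. *)
Lemma fps_rootX_unique k D E : k%:R != 0 :> K -> Fser1 D -> Fser1 E ->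
  D 1%N = E 1%N -> D ^+ k = E ^+ k -> D = E.
Proof.
move=> k0 [d d0 <-] [e e0 <-]; rewrite !fpsXM !exprMn => de /fpsXnI dek.
congr (_ * _); apply/eqP; rewrite -subr_eq0.
have /eqP := subrXX d e k; rewrite dek subrr eq_sym => /eqP dE.
set s := \sum_(i < k) _ in dE.
have sU : s \is a GRing.unit.
  rewrite fps_unitE fps_sum (eq_bigr (fun=> e 0%N ^+ k.-1)) => [|i _].
    by rewrite sumr_const card_ord -mulr_natl mulf_neq0 ?expf_neq0.
  rewrite fpsM0 !fpsX0 de -exprD; congr (_ ^+ _).
  by case: (k) i => [[]//|m] i /=; rewrite subnK // -ltnS.
by rewrite -[d - e](mulrK sU) dE mul0r.
Qed.

(** * Composition *)

(** Only the terms of degree at most [n] contribute to the coefficient of [X^n]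
    in [p(F)], as [F^j] has order at least [j]. *)
Lemma fps_horner (p : {poly K}) F n : F 0%N = 0 ->
  (map_poly (@fpsC K) p).[F] n = \sum_(j < n.+1) p`_j * (F ^+ j) n.
Proof.
move=> F0; pose m := maxn (size p) n.+1.
rewrite (@horner_coef_wide _ m) ?size_map_poly ?leq_maxl // fps_sum.
rewrite (big_ord_widen m (fun j => p`_j * (F ^+ j) n)) ?leq_maxr //.
rewrite [RHS]big_mkcond; apply: eq_bigr => j _.
rewrite coef_map fpsCM ltnS; case: leqP => // nj.
by rewrite fpsX_lt // mulr0.
Qed.

(** The sum defining the coefficient of [X^n] in [a(F)] may be extended to any
    range [j <= m] with [n <= m]. *)
Lemma fps_compE m a F n : F 0%N = 0 -> (n <= m)%N ->
  fps_comp a F n = \sum_(j < m.+1) a j * (F ^+ j) n.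
Proof.
move=> F0 nm; rewrite [LHS](big_ord_widen m.+1 (fun j => a j * (F ^+ j) n)) //.
rewrite [LHS]big_mkcond; apply: eq_bigr => j _.
by rewrite ltnS; case: leqP => // nj; rewrite fpsX_lt // mulr0.
Qed.

Lemma fps_comp_horner m a F n : F 0%N = 0 -> (n <= m)%N ->
  fps_comp a F n = (map_poly (@fpsC K) (fps_trunc m a)).[F] n.
Proof.
move=> F0 nm; rewrite fps_horner //; apply: eq_bigr => j _.
by rewrite coef_poly ltnS (leq_trans _ nm) // -ltnS.
Qed.

Lemma fps_compM a b F : F 0%N = 0 ->
  fps_comp (a * b) F = fps_comp a F * fps_comp b F.
Proof.
move=> F0; apply: fpsP => n.
transitivity ((map_poly (@fpsC K) (fps_trunc n a * fps_trunc n b)).[F] n).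
  rewrite fps_horner //; apply: eq_bigr => j _; congr (_ * _).
  rewrite fpsM coefM; apply: eq_bigr => i _; rewrite !coef_poly !ltnS.
  have jn : (j <= n)%N by rewrite -ltnS.
  by rewrite !(leq_trans _ jn) ?leq_subr // -ltnS.
rewrite rmorphM hornerM /=.
have E c :
    fps_eqmod n.+1 (map_poly (@fpsC K) (fps_trunc n c)).[F] (fps_comp c F).
  by move=> i ni; rewrite (fps_comp_horner n).
exact: (fps_eqmodM _ _ _ _ _ (E a) (E b) n (ltnSn n)).
Qed.

Lemma fps_compD a b F : fps_comp (a + b) F = fps_comp a F + fps_comp b F.
Proof.
apply: fpsP => n; rewrite fpsD -big_split; apply: eq_bigr => j _.
by rewrite fpsD mulrDl.
Qed.

Lemma fps_compC u F : fps_comp (fpsC u) F = fpsC u.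
Proof.
apply: fpsP => n; rewrite /= big_ord_recl expr0 big1 => [|i _];
  last by rewrite mul0r.
by rewrite addr0 fpsE1; case: n => [|n]; rewrite ?mulr1 ?mulr0.
Qed.

Lemma fps_compX a F j : F 0%N = 0 -> fps_comp (a ^+ j) F = fps_comp a F ^+ j.
Proof.
move=> F0; elim: j => [|j IH]; first exact: fps_compC.
by rewrite !exprS fps_compM // IH.
Qed.

Lemma fps_comp0 a F : fps_comp a F 0%N = a 0%N.
Proof. by rewrite /= big_ord1 expr0 mulr1. Qed.

Lemma fps_comp1 a F : F 0%N = 0 -> fps_comp a F 1%N = a 1%N * F 1%N.
Proof.
by rewrite /= !big_ord_recl big_ord0 expr0 expr1 fpsE1 mulr0 add0r addr0.
Qed.

Lemma fps_compXl F : F 0%N = 0 -> fps_comp fpsX F = F.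
Proof.
move=> F0; apply: fpsP => n; rewrite (fps_compE n.+1) //.
rewrite !big_ord_recl /= mul0r add0r mul1r expr1 big1 ?addr0 // => i _.
by rewrite mul0r.
Qed.

Lemma fps_compXr a : fps_comp a fpsX = a.
Proof.
apply: fpsP => n; rewrite /= big_ord_recr /= fpsXnE eqxx mulr1.
rewrite big1 ?add0r // => i _; rewrite fpsXnE.
by rewrite gtn_eqF ?mulr0.
Qed.

Lemma fps_compA h F G : F 0%N = 0 -> G 0%N = 0 ->
  fps_comp (fps_comp h F) G = fps_comp h (fps_comp F G).
Proof.
move=> F0 G0; apply: fpsP => n.
transitivity (\sum_(j < n.+1) \sum_(i < n.+1) h i * ((F ^+ i) j * (G ^+ j) n)).
  apply: eq_bigr => j _; have jn : (j <= n)%N by rewrite -ltnS.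
  rewrite (fps_compE n) // mulr_suml.
  by apply: eq_bigr => i _; rewrite mulrA.
rewrite exchange_big; apply: eq_bigr => i _.
by rewrite -mulr_sumr -fps_compX.
Qed.

Lemma Fser1_comp F G : Fser1 F -> Fser1 G -> Fser1 (fps_comp F G).
Proof.
move=> /Fser1P[F0 F1] /Fser1P[G0 G1]; apply/Fser1P.
by rewrite fps_comp0 fps_comp1 // mulf_neq0.
Qed.

Lemma fps_comp_eqmod n a F G : fps_eqmod n F G ->
  fps_eqmod n (fps_comp a F) (fps_comp a G).
Proof.
move=> FG i ni; apply: eq_bigr => j _; congr (_ * _).
exact: (fps_eqmodX n).
Qed.

(** The right inverse [G] of [H = X s] is the solution of [G = X / s(G)]; the
    [n]-th coefficient of the right-hand side only involves those of [G] below
    [n], thanks to the factor [X]. *)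
Lemma fps_comp_rinv H : Fser1 H -> exists G, Fser1 G /\ fps_comp H G = fpsX.
Proof.
move=> [s s0 <-].
have sU G : fps_comp s G \is a GRing.unit by rewrite fps_unitE fps_comp0.
have [G GE] : exists G, fpsX * (fps_comp s G)^-1 = G.
  apply: fps_fixpoint => n G G' GG'; rewrite [LHS]fpsXM [RHS]fpsXM.
  case: n GG' => [//|n] GG'.
  have sGG' := fps_comp_eqmod _ s _ _ GG'.
  exact: (fps_eqmodV _ _ _ (sU G) (sU G') sGG' n (ltnSn n)).
have G1 : Fser1 G.
  exists (fps_comp s G)^-1 => //; rewrite /Fser0 /mkset.
  by rewrite -fps_unitE unitrV.
have [G0 _] := (Fser1P _).1 G1.
exists G; split => //; rewrite fps_compM // fps_compXl //.
by rewrite -[X in X * _]GE mulrVK.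
Qed.

(** [H] has a right inverse [G], which itself has a right inverse [H'];
    by associativity [H' = H], so that [G] is a two-sided inverse. *)
Lemma fps_compinvP H : Fser1 H ->
  [/\ Fser1 (fps_compinv H), fps_comp H (fps_compinv H) = fpsX
    & fps_comp (fps_compinv H) H = fpsX].
Proof.
move=> HF.
apply: (@xgetPex _ 0
  [set G : fps K | [/\ Fser1 G, fps_comp H G = fpsX & fps_comp G H = fpsX]]).
have [G [GF HG]] := fps_comp_rinv _ HF; exists G; split => //.
have [H' [HF' GH']] := fps_comp_rinv _ GF.
have [H0 _] := (Fser1P _).1 HF; have [G0 _] := (Fser1P _).1 GF.
have [H'0 _] := (Fser1P _).1 HF'.
suff HE : H = H' by rewrite [X in fps_comp _ X]HE.
by rewrite -[H]fps_compXr -GH' -fps_compA // HG fps_compXl.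
Qed.

(** * Stabilizers *)

Lemma ltmulv_riordan g F (h : nat -> K) : F 0%N = 0 ->
  FPS (ltmulv (riordan g F) h) = g * fps_comp (FPS h) F.
Proof.
move=> F0; apply: fpsP => n; rewrite fpsM /=.
transitivity (\sum_(j < n.+1) \sum_(i < n.+1) g i * (h j * (F ^+ j) (n - i)%N)).
  apply: eq_bigr => j _; rewrite /riordan fpsM mulr_suml.
  by apply: eq_bigr => i _; rewrite mulrAC mulrA.
rewrite exchange_big; apply: eq_bigr => i _.
by rewrite -mulr_sumr -(fps_compE n (FPS h)) ?leq_subr.
Qed.

Lemma stab_riordanP g F (h : nat -> K) : Fser0 g -> Fser1 F ->
  stab h (riordan g F) <-> g * fps_comp (FPS h) F = FPS h.
Proof.
move=> gF FF; have [F0 _] := (Fser1P _).1 FF; rewrite -ltmulv_riordan //.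
split=> [[_ ->] //|E]; split; first by exists g => //; exists F.
by case: E.
Qed.

Lemma HserP k (h : nat -> K) : k%:R != 0 :> K -> h k != 0 ->
    (forall n, (0 < n < k)%N -> h n = 0) ->
  [/\ Fser1 (Hser k h), Hser k h 1%N = 1
    & FPS h = fpsC (h 0%N) + fpsC (h k) * Hser k h ^+ k].
Proof.
move=> k0 hk h_gap.
have k_gt0 : (0 < k)%N by case: k k0 {hk h_gap}; rewrite ?eqxx.
have B0 : FPS (fun n => h (k + n)%N / h k) 0%N = 1 by rewrite /= addn0 divff.
have [S0 SB] := fps_root1P _ _ k0 B0.
have H1 : Hser k h 1%N = 1 by rewrite fpsXM S0.
split=> //; first by apply/Fser1P; rewrite H1 oner_eq0 fpsXM.
apply: fpsP => n; rewrite fpsD fpsCM exprMn SB fpsXnM /=.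
case: ltnP => [nk|kn].
  by case: n nk => [|n] nk; rewrite mulr0 addr0 // h_gap.
rewrite subnKC // mulrC mulfVK //.
by case: n kn => [|n]; rewrite ?add0r // leqNgt k_gt0.
Qed.

(** The coefficient of [X^k] in a [k]-th power of a series without constant
    term. *)
Lemma Fser1_expE k D : Fser1 D ->
  (forall n, (n < k)%N -> (D ^+ k) n = 0) /\ (D ^+ k) k = D 1%N ^+ k.
Proof.
move=> [d _ <-]; split=> [n nk|]; first by rewrite fpsX_lt // fpsXM.
by rewrite exprMn fpsXnM ltnn subnn fpsX0 fpsXM.
Qed.

(** Multiplication by an invertible series preserves the [X]-adic order. *)
Lemma fps_unitM_order k g C : g 0%N != 0 ->
  (forall n, (n < k)%N -> C n = 0) <-> (forall n, (n < k)%N -> (g * C) n = 0).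
Proof.
move=> g0; have gU : g \is a GRing.unit by [].
have lt0 a b : fps_eqmod k b 0 -> fps_eqmod k (a * b) 0.
  move=> b0 i ik.
  by rewrite (fps_eqmodM _ _ _ _ _ (fun _ _ => erefl) b0 i ik) mulr0.
by split=> [/(lt0 g)//|/(lt0 g^-1)]; rewrite mulKr.
Qed.

Lemma fps_mul_lead k g C : (forall n, (n < k)%N -> C n = 0) ->
  (g * C) k = g 0%N * C k.
Proof.
move=> /fps_dvdXn {1}->; rewrite mulrCA fpsXnM ltnn subnn fpsM0 /=.
by rewrite addn0.
Qed.

(** Solving [H(F)^k = C] for [F]: this is possible only if [C] has the order
    and leading coefficient of a [k]-th power, and the solution is then
    determined by its linear coefficient. *)
Lemma fps_compinv_root k H F C :
    k%:R != 0 :> K -> Fser1 H -> H 1%N = 1 -> Fser1 F ->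
  fps_comp H F ^+ k = C <->
  [/\ (forall n, (n < k)%N -> C n = 0), C k = F 1%N ^+ k
    & F = fps_comp (fps_compinv H) (fps_rootX k (F 1%N) C)].
Proof.
move=> k0 HF H1 FF; have [[H0 _] [F0 F1]] := ((Fser1P _).1 HF, (Fser1P _).1 FF).
have [H'F HH' H'H] := fps_compinvP _ HF; have [H'0 _] := (Fser1P _).1 H'F.
have HFF := Fser1_comp _ _ HF FF.
have HF1 : fps_comp H F 1%N = F 1%N by rewrite fps_comp1 // H1 mul1r.
set D := fps_rootX _ _ _.
have DP : (exists D, [/\ Fser1 D, D 1%N = F 1%N & D ^+ k = C]) ->
    [/\ Fser1 D, D 1%N = F 1%N & D ^+ k = C].
  exact: (@xgetPex _ 0 [set D | [/\ Fser1 D, D 1%N = F 1%N & D ^+ k = C]]).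
split=> [HC|[Clt Ck FE]].
  have [Clt Ck] := Fser1_expE k _ HFF; rewrite HC in Clt Ck.
  split=> //; first by rewrite Ck HF1.
  have [|DF D1 DC] := DP; first by exists (fps_comp H F).
  have -> : D = fps_comp H F by apply: (fps_rootX_unique k); rewrite ?HF1 ?HC.
  by rewrite -fps_compA // H'H fps_compXl.
have [|DF D1 DC] := DP; first exact: fps_rootX_exists.
have [D0 _] := (Fser1P _).1 DF.
by rewrite FE -fps_compA // HH' fps_compXl.
Qed.

(** Membership in the stabilizer, up to the translation of the conditions
    on [C = h_k^-1 (h/g - h_0)] into conditions on [g]. *)
Lemma stab_riordan_root k g F (h : nat -> K)
    (C := fpsC (h k)^-1 * (FPS h / g - fpsC (h 0%N))) :
    k%:R != 0 :> K -> Fser0 g -> Fser1 F -> h k != 0 ->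
    (forall n, (0 < n < k)%N -> h n = 0) ->
  stab h (riordan g F) <->
  [/\ (forall n, (n < k)%N -> C n = 0), C k = F 1%N ^+ k
    & F = fps_comp (fps_compinv (Hser k h)) (Dser k h g (F 1%N))].
Proof.
move=> k0 gF FF hk h_gap; have gU : g \is a GRing.unit by exact: gF.
have hU : fpsC (h k) \is a GRing.unit by exact: hk.
have [F0 _] := (Fser1P _).1 FF; have [HF H1 hE] := HserP _ _ k0 hk h_gap.
rewrite stab_riordanP // -fps_compinv_root //.
have -> : fps_comp (FPS h) F =
          fpsC (h 0%N) + fpsC (h k) * fps_comp (Hser k h) F ^+ k.
  by rewrite {1}hE fps_compD fps_compM // !fps_compC fps_compX.
have CE : FPS h = g * (fpsC (h 0%N) + fpsC (h k) * C).
  rewrite /C mulrA -rmorphM /= mulfV // mul1r addrC subrK mulrC divrK //.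
rewrite {1}CE; split=> [/(mulrI gU)/addrI/(mulrI hU) //|-> //].
Qed.

End PowerSeries.

Theorem theorem4p2 (R : realType) (K : numFieldType)
  (hK : real_or_complex R K)
  (g F : fps K) (hg : Fser0 g) (hF : Fser1 F)
  (h : nat -> K) (k : nat) (k_ge1 : (1 <= k)%N) (hk_neq0 : h k != 0)
  (h_gap : forall n : nat, (0 < n < k)%N -> h n = 0) :
  (h 0%N != 0 ->
     (stab h (riordan g F) <->
      [/\ g 0%N = 1,
          (forall n : nat, (0 < n < k)%N -> g n = 0),
          (F 1%N) ^+ k = (h k - h 0%N * g k) / h k
        & F = fps_comp (fps_compinv (Hser k h)) (Dser k h g (F 1%N))])) /\
  (h 0%N = 0 ->
     (stab h (riordan g F) <->
      (F 1%N) ^+ k = 1 / g 0%N /\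
      F = fps_comp (fps_compinv (Hser k h)) (Dser k h g (F 1%N)))).
Proof.
have k0 : k%:R != 0 :> K by rewrite pnatr_eq0 -lt0n.
have g0 : g 0%N != 0 by exact: hg.
have := stab_riordan_root k g F h k0 hg hF hk_neq0 h_gap.
set C := fpsC _ * _ => stabP.
have gCE n : (g * C) n = (h n - h 0%N * g n) / h k.
  have -> : g * C = fpsC (h k)^-1 * (FPS h - fpsC (h 0%N) * g).
    by rewrite mulrCA mulrBr mulrCA mulrV // mulr1 [g * fpsC _]mulrC.
  by rewrite fpsCM fpsD fpsN fpsCM mulrC.
have Cord := fps_unitM_order k g C g0.
split=> h0; rewrite stabP.
- split=> [[Clt Ck FE]|[g01 gn Fk FE]].
    have hg_lt n : (n < k)%N -> h n = h 0%N * g n.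
      move=> /(Cord.1 Clt) /eqP; rewrite gCE mulf_eq0 invr_eq0 (negPf hk_neq0).
      by rewrite orbF subr_eq0 => /eqP.
    have g01 : g 0%N = 1 by apply: (mulfI h0); rewrite mulr1 -hg_lt.
    split=> // [n /andP[n0 nk]|].
      by apply: (mulfI h0); rewrite mulr0 -hg_lt // h_gap // n0.
    by rewrite -gCE fps_mul_lead // g01 mul1r Ck.
  have Clt : forall n, (n < k)%N -> C n = 0.
    apply: Cord.2 => -[|n] nk; rewrite gCE.
      by rewrite g01 mulr1 subrr mul0r.
    by rewrite gn // h_gap // mulr0 subrr mul0r.
  by split=> //; rewrite Fk -gCE fps_mul_lead // g01 mul1r.
- have Clt : forall n, (n < k)%N -> C n = 0.
    apply: Cord.2 => n nk; rewrite gCE h0 mul0r subr0.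
    by case: n nk => [|n] nk; rewrite ?h0 ?(h_gap n.+1) ?mul0r.
  have -> : 1 / g 0%N = C k.
    have := gCE k; rewrite fps_mul_lead // h0 mul0r subr0 divff // => <-.
    by rewrite mulrC mulKf.
  split=> [[_ Ck FE]|[Fk FE]]; first by rewrite Ck.
  by split; [exact: Clt | rewrite Fk | exact: FE].
Qed.
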